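(* Let $\Gamma=(G,\sigma)$ be a connected signed graph on $n\geq 2$ vertices $1,2,\ldots,n$ with an incidence matrix $N$, and let $N^\dagger$ be the Moore–Penrose inverse of $N$. \begin{enumerate} \item[(a)] If $\Gamma$ is unbalanced, then $NN^\dagger=I_n$. \item[(b)] If $\Gamma$ is balanced, then $NN^\dagger=I_n-\frac{1}{n}S$, where $S$ is the path sign matrix of $\Gamma$. \end{enumerate}
   Context: A signed graph $\Gamma=(G,\sigma)$ consists of a simple graph $G=(V,E)$ with $V=\{1,\ldots,n\}$, $E=\{e_1,\ldots,e_m\}$, and $\sigma:E\to\{-1,1\}$; an edge $e$ is positive if $\sigma(e)=1$, negative if $\sigma(e)=-1$. The sign of a path is the product of $\sigma$ over its edges. A cycle is balanced if it contains an even number of negative edges; $\Gamma$ is balanced if all its cycles are balanced, otherwise unbalanced. (In a connected balanced signed graph all paths between two given vertices have the same sign.) An incidence matrix of $\Gamma$ is an $n\times m$ matrix $N=[n_{k\ell}]$ (rows indexed by vertices, columns by edges) such that for each edge $e_\ell=\{i,j\}$, column $\ell$ has exactly two nonzero entries $n_{i\ell},n_{j\ell}\in\{1,-1\}$, with $n_{i\ell}=n_{j\ell}$ if $e_\ell$ is negative and $n_{i\ell}=-n_{j\ell}$ if $e_\ell$ is positive. For a connected balanced $\Gamma$, the path sign matrix is the $n\times n$ matrix $S=[s_{ij}]$ with $s_{ii}=1$ and, for $i\ne j$, $s_{ij}$ equal to the sign of a (any) path between $i$ and $j$. *)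

(* Defs.v *)
From HB Require Import structures.
From mathcomp Require Import all_boot all_order all_algebra.

Set Implicit Arguments.
Unset Strict Implicit.
Unset Printing Implicit Defensive.

Import Order.TTheory GRing.Theory Num.Theory.

Local Open Scope ring_scope.

(* Vertices are 'I_n and [edge] is an enumeration e_1, ..., e_m of E without
   repetition.  Only the values of [sigma] on edges are ever used. *)
Record signed_graph (n m : nat) := SignedGraph {
  edge : 'I_m -> {set 'I_n};
  sigma : {set 'I_n} -> int;
  edge_inj : injective edge;
  card_edge : forall l, #|edge l| = 2%N;
  sigma_edge : forall l, sigma (edge l) = 1 \/ sigma (edge l) = -1
}.

Section SignedGraph.

Variables (n m : nat) (G : signed_graph n m).

Definition adj : rel 'I_n := fun x y => [exists l, edge G l == [set x; y]].

Definition sg_connected : Prop := forall x y, connect adj x y.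

(* The path with vertex sequence x :: p, and its edge sequence. *)
Definition is_path (x y : 'I_n) (p : seq 'I_n) : bool :=
  [&& path adj x p, uniq (x :: p) & last x p == y].

Definition path_edges (x : 'I_n) (p : seq 'I_n) : seq {set 'I_n} :=
  pairmap (fun u v => [set u; v]) x p.

Definition path_sign (x : 'I_n) (p : seq 'I_n) : int :=
  \prod_(e <- path_edges x p) sigma G e.

(* c lists the distinct vertices of the cycle in order, without repeating the
   first one at the end; [2 < size c] excludes a single edge traversed twice. *)
Definition is_cycle (c : seq 'I_n) : bool :=
  [&& (2 < size c)%N, cycle adj c & uniq c].

Definition cycle_edges (c : seq 'I_n) : seq {set 'I_n} :=
  if c is x :: p then path_edges x (rcons p x) else [::].

Definition cycle_balanced (c : seq 'I_n) : bool :=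
  ~~ odd (count (fun e => sigma G e == -1) (cycle_edges c)).

Definition balanced : Prop := forall c, is_cycle c -> cycle_balanced c.

Definition unbalanced : Prop := ~ balanced.

Variable R : realFieldType.

Definition is_incidence_matrix (N : 'M[R]_(n, m)) : Prop :=
  forall l : 'I_m,
  [/\ forall k, k \notin edge G l -> N k l = 0,
      forall k, k \in edge G l -> N k l = 1 \/ N k l = -1
    & forall i j, edge G l = [set i; j] ->
        (sigma G (edge G l) = -1 -> N i l = N j l) /\
        (sigma G (edge G l) = 1 -> N i l = - N j l)].

(* Each off-diagonal entry is the sign of some path; that the choice of path
   is immaterial for connected balanced graphs is not built in. *)
Definition is_path_sign_matrix (S : 'M[R]_n) : Prop :=
  (forall i, S i i = 1) /\
  (forall i j, i != j ->
     exists2 p, is_path i j p & S i j = (path_sign i p)%:~R).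

Lemma path_sign_matrix_exists :
  sg_connected -> exists S, is_path_sign_matrix S.
Proof.
move=> Gconn.
have ex i j : exists p, is_path i j p.
  have /connectP[q qP ->] := Gconn i j.
  case/shortenP: qP => p pP pU _.
  by exists p; rewrite /is_path pP pU eqxx.
exists (\matrix_(i, j)
  if i == j then 1 else (path_sign i (xchoose (ex i j)))%:~R).
split=> [i|i j nij]; first by rewrite mxE eqxx.
exists (xchoose (ex i j)); first exact: xchooseP.
by rewrite mxE (negPf nij).
Qed.

End SignedGraph.

Section MoorePenrose.

Variable R : realFieldType.

Definition is_moore_penrose_inverse m n (A : 'M[R]_(m, n)) (X : 'M[R]_(n, m)) :
    Prop :=
  [/\ A *m X *m A = A,
      X *m A *m X = X,
      (A *m X)^T = A *m X
    & (X *m A)^T = X *m A].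

Lemma moore_penrose_inverse_unique m n (A : 'M[R]_(m, n)) X Y :
  is_moore_penrose_inverse A X -> is_moore_penrose_inverse A Y -> X = Y.
Proof.
move=> [X1 X2 X3 X4] [Y1 Y2 Y3 Y4].
have eqA : A *m X = A *m Y.
  by rewrite -X3 -[in LHS]Y1 -mulmxA trmx_mul X3 Y3 mulmxA X1.
have eqB : X *m A = Y *m A.
  by rewrite -X4 -[in LHS]Y1 -mulmxA mulmxA trmx_mul Y4 X4 -mulmxA [A *m _]mulmxA X1.
by rewrite -X2 -mulmxA eqA mulmxA eqB Y2.
Qed.

Lemma mulmx_trmx_unit r n (C : 'M[R]_(r, n)) :
  row_free C -> C *m C^T \in unitmx.
Proof.
move=> Cfree; rewrite -row_free_unit -kermx_eq0; apply/eqP/row_matrixP => i.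
rewrite row0; set x := row i _.
have /eqP : x *m (C *m C^T) = 0 by apply/sub_kermxP; exact: row_sub.
have [xC0 _|/rV0Pn[k nz]] := eqVneq (x *m C) 0.
  by apply: (row_free_inj Cfree); rewrite xC0 mul0mx.
move=> /eqP xCC; have /matrixP/(_ 0 0) : x *m C *m (x *m C)^T = 0.
  by rewrite trmx_mul mulmxA -[x *m C *m _]mulmxA xCC mul0mx.
rewrite !mxE => /psumr_eq0P sum0.
have := sum0 _ k isT; rewrite [_^T _ _]mxE -expr2 => h.
by case/negP: nz; rewrite -sqrf_eq0 h // => j _; rewrite [_^T _ _]mxE -expr2 sqr_ge0.
Qed.

Lemma moore_penrose_inverse_exists m n (A : 'M[R]_(m, n)) :
  exists X, is_moore_penrose_inverse A X.
Proof.
rewrite -{1}[A](mulmx_base A).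
move: (row_base_free A) (col_base_full A).
move: (\rank A) (col_base A) (row_base A) => r B C Cfree Bfull {A}.
have uC : C *m C^T \in unitmx by exact: mulmx_trmx_unit.
have uB : B^T *m B \in unitmx.
  rewrite -[X in _ *m X]trmxK; apply: mulmx_trmx_unit.
  by rewrite /row_free mxrank_tr; exact: Bfull.
pose P := invmx (C *m C^T); pose Q := invmx (B^T *m B).
have PT : P^T = P by rewrite /P trmx_inv trmx_mul trmxK.
have QT : Q^T = Q by rewrite /Q trmx_inv trmx_mul trmxK.
exists (C^T *m P *m (Q *m B^T)).
have AX : B *m C *m (C^T *m P *m (Q *m B^T)) = B *m Q *m B^T.
  rewrite !mulmxA -[B *m C *m C^T]mulmxA -[B *m (C *m C^T) *m P]mulmxA.
  by rewrite /P mulmxV // mulmx1.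
have XA : C^T *m P *m (Q *m B^T) *m (B *m C) = C^T *m P *m C.
  rewrite !mulmxA -[_ *m B^T *m B]mulmxA -[_ *m Q *m (B^T *m B)]mulmxA.
  by rewrite /Q mulVmx // mulmx1.
split; rewrite ?AX ?XA.
- by rewrite mulmxA -[_ *m B^T *m B]mulmxA -[B *m Q *m _]mulmxA
     /Q mulVmx // mulmx1.
- rewrite !mulmxA -[_ *m C *m C^T]mulmxA -[C^T *m P *m _ *m P]mulmxA.
  by rewrite /P mulmxV // mulmx1.
- by rewrite !trmx_mul trmxK QT mulmxA.
- by rewrite !trmx_mul trmxK PT mulmxA.
Qed.

End MoorePenrose.

(* Main.v *)
Require Import Defs.
From HB Require Import structures.
From mathcomp Require Import all_boot all_order all_algebra.

Set Implicit Arguments.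
Unset Strict Implicit.
Unset Printing Implicit Defensive.

Import Order.TTheory GRing.Theory Num.Theory.

Local Open Scope ring_scope.

(** Let Q = I - N N^dagger, which is symmetric with Q N = 0.  A row vector v
    satisfies v N = 0 exactly when v_i = sigma(ij) v_j on every edge ij, hence
    v_i is v_j times the sign of any walk from i to j.  A nonzero such v has no
    zero entry, so going round a cycle forces its sign to be 1: Q = 0 unless
    the graph is balanced.  In the balanced case every closed walk has sign 1,
    so S N = 0, S^2 = n S, and Q_ij = S_ij Q_ii; symmetry of Q makes its
    diagonal constant, Q = q S, and S = S Q = q n S gives q = 1/n. *)

(** Used to cut a walk at a vertex [y] it visits twice: [s2] followed by [y] is a loop at [y], and
    [s1 ++ y :: s3] is the walk without that loop. *)
Lemma not_uniq_split (T : eqType) (s : seq T) :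
  ~~ uniq s -> exists y s1 s2 s3, s = s1 ++ y :: s2 ++ y :: s3.
Proof.
elim: s => //= a s IHs; rewrite negb_and negbK.
case/orP=> [/splitPr[s2 s3]|/IHs[y [s1 [s2 [s3 ->]]]]].
  by exists a, [::], s2, s3.
by exists y, (a :: s1), s2, s3.
Qed.

Section Walks.

Variables (n m : nat) (G : signed_graph n m).

Lemma adj_neq x y : adj G x y -> x != y.
Proof.
case/existsP=> l /eqP El; apply/eqP=> xy; have := card_edge G l.
by rewrite El xy setUid cards1.
Qed.

Lemma adj_sigma x y :
  adj G x y -> sigma G [set x; y] = 1 \/ sigma G [set x; y] = -1.
Proof. by case/existsP=> l /eqP <-; exact: sigma_edge. Qed.

Lemma path_sign_nil x : path_sign G x [::] = 1.
Proof. by rewrite /path_sign big_nil. Qed.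

Lemma path_sign_cons x y p :
  path_sign G x (y :: p) = sigma G [set x; y] * path_sign G y p.
Proof. by rewrite /path_sign big_cons. Qed.

Lemma path_sign_cat x p q :
  path_sign G x (p ++ q) = path_sign G x p * path_sign G (last x p) q.
Proof. by rewrite /path_sign /path_edges pairmap_cat big_cat. Qed.

(** Turns the product of signs into the parity count in which [cycle_balanced] is phrased. *)
Lemma path_signE x p : path (adj G) x p ->
  path_sign G x p =
    (-1) ^+ count (fun e => sigma G e == -1) (path_edges x p).
Proof.
elim: p x => [|y p IHp] x /=; first by rewrite path_sign_nil.
case/andP=> /adj_sigma sxy /IHp IH; rewrite path_sign_cons IH exprD.
by case: sxy => ->.
Qed.

Lemma path_sign_sqr x p :
  path (adj G) x p -> path_sign G x p * path_sign G x p = 1.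
Proof. by move=> /path_signE ->; rewrite -expr2 sqrr_sign. Qed.

Lemma path_sign_neq0 x p : path (adj G) x p -> path_sign G x p != 0.
Proof. by move=> /path_signE ->; rewrite signr_eq0. Qed.

Lemma path_sign_eq1 x p : path (adj G) x p ->
  (path_sign G x p == 1) =
    ~~ odd (count (fun e => sigma G e == -1) (path_edges x p)).
Proof. by move=> /path_signE ->; rewrite -signr_odd; case: odd. Qed.

(* A closed walk with a repeated vertex splits into two shorter ones. *)
Lemma closed_walk_sign x p :
  balanced G -> path (adj G) x p -> last x p = x -> path_sign G x p = 1.
Proof.
move=> Gbal; move: {2}_.+1 (ltnSn (size p)) => k.
elim: k x p => // k IHk x p; rewrite ltnS => le_p_k xp px.
(* Uniqueness is tested on [p], not on [x :: p]: a closed walk always meets [x] again at its end. *)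
have [Up|/not_uniq_split[y [p1 [p2 [p3 Dp]]]]] := boolP (uniq p).
  case: (lastP p) px xp Up {le_p_k} => [|q z]; first by rewrite path_sign_nil.
  rewrite last_rcons => -> xp; rewrite rcons_uniq => Uq.
  (* Too short to be a cycle: either a loop at [x], which [adj_neq] forbids, or one edge traversed
     there and back, of sign a square. *)
  have [q_gt1|q_le1] := ltnP 1 (size q); last first.
    case: q q_le1 xp {Uq} => [|y [|]] //= _; first by case/andP=> /adj_neq/eqP.
    rewrite !path_sign_cons path_sign_nil mulr1 [[set y; x]]setUC.
    by case/andP=> /adj_sigma[] ->.
  apply/eqP; rewrite path_sign_eq1 //; apply: (Gbal (x :: q)).
  by rewrite /is_cycle /= ltnS q_gt1 xp.
move: le_p_k xp px; rewrite Dp !size_cat /= size_cat /= => le_p_k.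
rewrite cat_path /= cat_path /= last_cat /= last_cat /=.
case/and5P=> xp1 p1y yp2 p2y yp3 p3x.
have s2 : path_sign G y (rcons p2 y) = 1.
  apply: IHk; rewrite ?last_rcons ?rcons_path ?yp2 // size_rcons.
  by apply: leq_trans le_p_k; rewrite !addnS !ltnS addnCA leq_addr.
have s13 : path_sign G x (p1 ++ y :: p3) = 1.
  apply: IHk; rewrite ?cat_path ?last_cat /= ?xp1 ?p1y // size_cat /=.
  by apply: leq_trans le_p_k; rewrite !addnS !ltnS leq_add2l leq_addl.
rewrite -(cat_rcons y p2) path_sign_cat path_sign_cons path_sign_cat last_rcons s2 mul1r.
by rewrite -path_sign_cons -path_sign_cat.
Qed.

(* Both walks are closed up by the same walk back, so no reversal is needed. *)
Lemma walk_sign_unique x p q :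
  sg_connected G -> balanced G -> path (adj G) x p -> path (adj G) x q ->
  last x p = last x q -> path_sign G x p = path_sign G x q.
Proof.
move=> Gconn Gbal xp xq pq; have /connectP[r qr rx] := Gconn (last x q) x.
apply: (mulIf (path_sign_neq0 qr)); rewrite -{1}pq -!path_sign_cat.
by rewrite !closed_walk_sign // ?cat_path ?last_cat ?pq ?xp ?xq ?qr.
Qed.

Section Incidence.

Variables (R : realFieldType) (N : 'M[R]_(n, m)).
Hypothesis N_incidence : is_incidence_matrix G N.

Lemma incidence_entry l a b :
  edge G l = [set a; b] -> N a l = - ((sigma G [set a; b])%:~R * N b l).
Proof.
move=> El; have [_ _ /(_ a b El)] := N_incidence l; rewrite -El.
case: (sigma_edge G l) => -> [eqN oppN].
  by rewrite mulr1z mul1r oppN.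
by rewrite mulrN1z mulN1r opprK eqN.
Qed.

(** Column [l] has only the entries at [a] and [b], and the first is a multiple of the second by
    [incidence_entry]. *)
Lemma mul_incidence k (A : 'M[R]_(k, n)) i l a b : edge G l = [set a; b] ->
  (A *m N) i l = (A i b - (sigma G [set a; b])%:~R * A i a) * N b l.
Proof.
move=> El; have ab : a != b by apply: adj_neq; apply/existsP; exists l; apply/eqP.
have [N0 _ _] := N_incidence l.
rewrite mxE (bigD1 a) //= (bigD1 b) 1?eq_sym //= big1 => [|c /andP[ca cb]].
  by rewrite (incidence_entry El) addr0 mulrN mulrCA addrC mulrBl mulrA.
by rewrite N0 ?mulr0 // El !inE negb_or ca.
Qed.

Lemma mul_incidence_eq0P k (A : 'M[R]_(k, n)) :
  A *m N = 0 <->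
  forall i a b, adj G a b -> A i b = (sigma G [set a; b])%:~R * A i a.
Proof.
split=> [AN0 i a b /existsP[l /eqP El]|AN].
  have [_ /(_ b) Nb _] := N_incidence l.
  have Nb0 : N b l != 0.
    by case: Nb => [|->|->]; rewrite ?oppr_eq0 ?oner_eq0 // El !inE eqxx orbT.
  apply/eqP; rewrite -subr_eq0 -(mulIr_eq0 _ (mulIf Nb0)).
  by rewrite -(mul_incidence _ i El) AN0 mxE.
apply/matrixP=> i l; have /eqP/cards2P[a [b [_ El]]] := card_edge G l.
rewrite (mul_incidence _ i El) (AN i a b) ?subrr ?mul0r ?mxE //.
by apply/existsP; exists l; apply/eqP.
Qed.

Lemma mul_incidence_walk k (A : 'M[R]_(k, n)) i x p :
  A *m N = 0 -> path (adj G) x p ->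
  A i (last x p) = (path_sign G x p)%:~R * A i x.
Proof.
move=> /mul_incidence_eq0P AN.
elim: p x => [|y p IHp] x /=; first by rewrite path_sign_nil mul1r.
case/andP=> xy /IHp ->.
by rewrite (AN i x y xy) path_sign_cons rmorphM mulrCA mulrA.
Qed.

Lemma left_kernel_balanced k (A : 'M[R]_(k, n)) :
  sg_connected G -> A *m N = 0 -> A != 0 -> balanced G.
Proof.
move=> Gconn AN0 A_neq0 [|x p] // /and3P[_ xpx _].
rewrite /cycle_balanced /= -path_sign_eq1 //.
have [i [j Aij]] : exists i j, A i j != 0.
  by apply/matrix0Pn.
(* By connectedness a zero at [x] would propagate along a walk to [j]. *)
have Aix : A i x != 0.
  have /connectP[q xq jq] := Gconn x j; apply: contraNneq Aij => Aix.
  by rewrite jq (mul_incidence_walk i AN0 xq) Aix mulr0.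
have := mul_incidence_walk i AN0 xpx; rewrite last_rcons.
by rewrite -{1}[A i x]mul1r => /(mulIf Aix)/esym/eqP; rewrite (eqr_int _ _ 1).
Qed.

End Incidence.

Section PathSignMatrix.

Variables (R : realFieldType) (S : 'M[R]_n).
Hypotheses (Gconn : sg_connected G) (Gbal : balanced G).
Hypothesis S_sign : is_path_sign_matrix G S.

(** The path chosen for each entry of [S] may be replaced by any walk, by [walk_sign_unique]; on the
    diagonal the walk is closed. *)
Lemma path_sign_matrix_walk x p :
  path (adj G) x p -> S x (last x p) = (path_sign G x p)%:~R.
Proof.
case: S_sign => S1 Sp xp; have [px|] := eqVneq x (last x p).
  by rewrite -px S1 closed_walk_sign.
case/Sp=> q /and3P[xq _ /eqP qp] ->.
by rewrite (walk_sign_unique Gconn Gbal xq xp qp).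
Qed.

(** Concatenate a walk from [i] to [j] with one from [j] to [k]. *)
Lemma path_sign_matrixM i j k : S i j * S j k = S i k.
Proof.
have /connectP[p ip ->] := Gconn i j.
have /connectP[q pq ->] := Gconn (last i p) k.
rewrite !path_sign_matrix_walk // -last_cat path_sign_matrix_walk.
  by rewrite path_sign_cat rmorphM.
by rewrite cat_path ip.
Qed.

Lemma mulmx_path_sign_matrix : S *m S = n%:R *: S.
Proof.
apply/matrixP=> i k; rewrite !mxE (eq_bigr (fun=> S i k)) => [|j _].
  by rewrite sumr_const card_ord mulr_natl.
exact: path_sign_matrixM.
Qed.

Lemma path_sign_matrix_incidence (N : 'M[R]_(n, m)) :
  is_incidence_matrix G N -> S *m N = 0.
Proof.
move=> N_inc; apply/(mul_incidence_eq0P N_inc) => i a b ab.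
(* The one-edge walk identifies the sign of the edge with [S a b]. *)
have := @path_sign_matrix_walk a [:: b]; rewrite /= ab path_sign_cons.
by rewrite path_sign_nil mulr1 => <- //; rewrite mulrC path_sign_matrixM.
Qed.

End PathSignMatrix.

End Walks.

Theorem theorem3p1 (R : realFieldType) (n m : nat) (G : signed_graph n m)
    (N : 'M[R]_(n, m)) (Nd : 'M[R]_(m, n))
    (n_ge2 : (2 <= n)%N)
    (G_connected : sg_connected G)
    (N_incidence : is_incidence_matrix G N)
    (Nd_mp : is_moore_penrose_inverse N Nd) :
  (unbalanced G -> N *m Nd = 1%:M) /\
  (balanced G -> forall S : 'M[R]_n, is_path_sign_matrix G S ->
     N *m Nd = 1%:M - n%:R^-1 *: S).
Proof.
have [NNdN _ NNdT _] := Nd_mp.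
pose Q := 1%:M - N *m Nd.
have QN : Q *m N = 0 by rewrite mulmxBl mul1mx NNdN subrr.
have NNdE : N *m Nd = 1%:M - Q by rewrite opprB addrC subrK.
split=> [Gunbal|Gbal S S_sign].
  have [Q0|Q_neq0] := eqVneq Q 0; first by rewrite NNdE Q0 subr0.
  by case: Gunbal; exact: left_kernel_balanced Q_neq0.
rewrite NNdE; congr (_ - _).
have Qsym i j : Q i j = Q j i.
  by rewrite -[in LHS](_ : Q^T = Q) ?mxE // linearB /= trmx1 NNdT.
have SQ : S *m Q = S.
  by rewrite mulmxBr mulmx1 mulmxA (path_sign_matrix_incidence G_connected)
     // mul0mx subr0.
clearbody Q.
have Qdiag i j : Q i j = S i j * Q i i.
  have /connectP[p ip ->] := G_connected i j.
  rewrite (mul_incidence_walk N_incidence i QN ip).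
  by rewrite (path_sign_matrix_walk G_connected).
have Ssqr i j : S i j * S i j = 1.
  have /connectP[p ip ->] := G_connected i j.
  by rewrite (path_sign_matrix_walk G_connected) // -rmorphM path_sign_sqr.
have S1 i : S i i = 1 by case: S_sign.
(* [S i j] is its own inverse, and its product with [S j i] is [S i i], that is 1. *)
have Ssym i j : S j i = S i j.
  rewrite -[LHS]mul1r -(Ssqr i j) -mulrA.
  by rewrite (path_sign_matrixM G_connected Gbal S_sign) S1 mulr1.
pose o : 'I_n := Ordinal (ltnW n_ge2).
have QE : Q = Q o o *: S.
  apply/matrixP=> i j; rewrite mxE Qdiag mulrC; congr (_ * _).
  (* The two sides are [Q i o] and [Q o i]; the factor [S o i] then cancels because its square is
     1. *)
  have : S o i * Q i i = S o i * Q o o by rewrite -Qdiag -Ssym -Qdiag Qsym.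
  by move/(congr1 ( *%R (S o i))); rewrite !mulrA Ssqr !mul1r.
have n_neq0 : n%:R != 0 :> R by rewrite pnatr_eq0 -lt0n ltnW.
rewrite [LHS]QE; congr (_ *: _); apply: (mulIf n_neq0); rewrite mulVf //.
(* With [Q] a multiple of [S], the [(o, o)] entry of [S *m Q = S] reads [Q o o * n = 1]. *)
have := SQ; rewrite QE -scalemxAr (mulmx_path_sign_matrix G_connected) //.
by move/matrixP/(_ o o); rewrite !mxE !S1 !mulr1.
Qed.
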